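(* Let $n,s,h,k \in \mathbb{Z}^+$ with $1 \leq s \leq n-2$, $k \leq \binom{n}{2}$, and $0 \leq h < n$. If $\gcd(s,n) = 1$, then there is an $s$-overlap cycle for $\mathcal{W}_k(n,h)$.
   Context: $\mathcal{W}(n)$ denotes the set of weak orders on $[n]$ (transitive and complete relations), represented as words: $\mathcal{W}(n)$ is the set of all words $w_1w_2\ldots w_n$ of length $n$ over the nonnegative integers such that $\{w_1,\dots,w_n\} = \{0,1,\dots,h\}$ for some $h$ with $0 \le h \le n-1$ (here $w_j$ is the height of element $j$ in the weak order). This $h$, i.e. the maximum letter of $w$, is the height of $w$; the weight of $w$ is $\sum_{i=1}^n w_i$. $\mathcal{W}_k(n,h)$ is the set of $w \in \mathcal{W}(n)$ of height $h$ and weight $k$. An $s$-overlap cycle ($s$-ocycle) for a set of words of length $n$ is a cyclically ordered listing of the words in the set, each appearing exactly once, such that the last $s$ letters of each word are the first $s$ letters (in the same order) of its successor in the listing (the successor of the last word being the first word). If the set is empty, the empty listing is an $s$-ocycle for it. *)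

(* Defs.v *)
From mathcomp Require Import all_boot.
Set Implicit Arguments.
Unset Strict Implicit.
Unset Printing Implicit Defensive.

(* A weak order on [n] is the word w whose j-th letter is the height of j:
   its set of letters is {0, 1, ..., h} for some h < n. *)
Definition weak_order_word (n : nat) (w : n.-tuple nat) : Prop :=
  exists2 h : nat, h < n & w =i iota 0 h.+1.

Definition height (n : nat) (w : n.-tuple nat) : nat := \max_(a <- w) a.

Definition weight (n : nat) (w : n.-tuple nat) : nat := \sum_(a <- w) a.

Definition weak_orders_hk (n h k : nat) (w : n.-tuple nat) : Prop :=
  [/\ weak_order_word w, height w = h & weight w = k].

Definition overlap (T : eqType) (n s : nat) : rel (n.-tuple T) :=
  fun u v => drop (n - s) u == take s v.

(* [cycle] also relates the last word to the first one; it holds for the empty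
   listing, and for [:: w] it requires w to overlap itself. *)
Definition is_ocycle (T : eqType) (n s : nat) (A : n.-tuple T -> Prop)
    (c : seq (n.-tuple T)) : Prop :=
  [/\ uniq c, forall w, w \in c <-> A w & cycle (overlap s) c].

(* Main.v *)
Require Import Defs.
From mathcomp Require Import all_boot.
From mathcomp Require Import perm zify.

(** An overlap cycle is an Eulerian circuit in the multigraph whose vertices
are the words of length s and in which a word w is an edge from its prefix to
its suffix.  Rotation by n - s sends w to a successor of w, so the words are
covered by disjoint cycles; taking a cover with the fewest cycles, any two words
with the same suffix lie on one cycle, as otherwise exchanging their successors
would merge their cycles.  It remains to see that the words are connected under
rotation and change of prefix.  Since s is prime to n, all rotations are
available, and a prefix has at least two letters, so any two letters a, b may be
swapped or replaced by a - 1, b + 1.  Keeping one copy of each of 0, ..., h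
aside, such moves connect any two words of the same weight. *)

(** * Eulerian circuits from permutations of the edges *)

(** The bijection [r] matches the edges ending at a vertex with those starting there. Connectivity
    takes the form of an induction principle for predicates on edges. *)
Lemma eulerian_circuit (A : finType) (V : eqType) (hd tl : A -> V)
    (r : {perm A}) :
    (forall a, tl (r a) = hd a) ->
    (forall P : pred A, (forall a, P a -> P (r a)) ->
       (forall a b, hd a = hd b -> P a -> P b) -> forall a b, P a -> P b) ->
  exists c : seq A, [/\ uniq c, c =i A & cycle (fun u v => hd u == tl v) c].
Proof.
move=> tl_r conn.
case: (pickP A) => [a0 _|A0]; last first.
  by exists [::]; split => // b; have := A0 b.
have r_succ : [forall a, tl (r a) == hd a] by apply/forallP => a; apply/eqP.
case: (@arg_minnP _ r (fun p : {perm A} => [forall a, tl (p a) == hd a])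
         (fun p => #|porbits p|) r_succ) => p /forallP p_succ p_min.
have p_tl a : tl (p a) = hd a by apply/eqP.
have same_hd a b : hd a = hd b -> a \in porbit p b.
  move=> hd_ab; apply/negPn/negP => ab_apart.
  (* For [a] and [b] in distinct orbits, exchanging their images merges the two and leaves one orbit
     fewer. *)
  have := porbits_mul_tperm p a b; rewrite /= ab_apart.
  have -> : a != b by apply: contraNneq ab_apart => ->; rewrite porbit_id.
  suff /p_min : [forall c, tl ((tperm a b * p)%g c) == hd c].
    by move=> /=; move: #|_| #|_| => i j; lia.
  apply/forallP => c; rewrite permM p_tl.
  by case: tpermP => [->|->|_ _]; rewrite ?hd_ab.
have one_porbit b : b \in porbit p a0.
  apply: (conn (fun b => b \in porbit p a0) _ _ a0); last exact: porbit_id.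
  - move=> a; rewrite -!eq_porbit_mem => /eqP <-.
    (* [r a] lies in the orbit of its preimage under [p], whose head is that of [a]. *)
    rewrite eq_porbit_mem -[r a](permKV p).
    have /same_hd : hd ((p^-1)%g (r a)) = hd a by rewrite -p_tl permKV tl_r.
    by rewrite -!eq_porbit_mem => /eqP <-; rewrite eq_porbit_mem (mem_porbit p 1).
  - by move=> a c /same_hd; rewrite -!eq_porbit_mem => /eqP ->.
exists (fingraph.orbit p a0); split; first exact: orbit_uniq.
- move=> b; rewrite -fconnect_orbit; have /porbitP[i ->] := one_porbit b.
  by rewrite permX fconnect_iter.
- apply: sub_cycle (cycle_orbit (@perm_inj _ p) a0) => a b /eqP <-.
  by rewrite p_tl.
Qed.

(** * Rotations and permutations of words *)

Lemma iter_rot1 (T : Type) (m : nat) (w : seq T) :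
  m <= size w -> iter m (rot 1) w = rot m w.
Proof.
by elim: m => [|m IHm] m_le /=; rewrite ?rot0 // [RHS]rotS // IHm // ltnW.
Qed.

(** By Bézout, [u * d = 1 + v * n] for some [u], [v]; hence [u] rotations by [d] amount to a single
    rotation by 1. *)
Lemma rot1_closed (T : Type) (n d : nat) (P : seq T -> Prop) :
    0 < n -> d <= n -> coprime d n -> (forall w, P w -> size w = n) ->
    (forall w, P w -> P (rot d w)) ->
  forall w, P w -> P (rot 1 w).
Proof.
move=> n_gt0 d_le co_dn P_size P_rot w Pw.
have d_gt0 : 0 < d \/ n = 1.
  by case: d co_dn {d_le P_rot}; rewrite /coprime ?gcd0n; lia.
case: d_gt0 => [d_gt0|n1]; last by rewrite rot_oversize ?(P_size _ Pw) ?n1.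
have [[u v] /= uv] := coprimeP n d_gt0 co_dn.
have P_iter i : P (iter (i * d) (rot 1) w).
  elim: i => // i IHi; rewrite mulSn iterD iter_rot1 ?(P_size _ IHi) //.
  exact: P_rot.
have iter_n i : iter (i * n) (rot 1) w = w.
  elim: i => // i IHi.
  by rewrite mulSn iterD IHi -(P_size _ Pw) iter_rot1 // rot_size.
have := P_iter u; rewrite (_ : u * d = 1 + v * n); last by lia.
by rewrite iterD iter_n.
Qed.

(** Rotations carry any adjacent pair to the front, so every adjacent swap is available, and these
    generate all permutations. *)
Lemma perm_closed (T : eqType) (P : seq T -> Prop) :
    (forall w, P w -> P (rot 1 w)) ->
    (forall a b z, P [:: a, b & z] -> P [:: b, a & z]) ->
  forall w w', perm_eq w w' -> P w -> P w'.
Proof.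
move=> P_rot P_swap.
have P_catC x y : P (x ++ y) -> P (y ++ x).
  elim: x y => [|a x IHx] y; first by rewrite cats0.
  by move/P_rot; rewrite rot1_cons rcons_cat => /IHx; rewrite cat_rcons.
have P_swap_in u a b v : P (u ++ [:: a, b & v]) -> P (u ++ [:: b, a & v]).
  by move/P_catC/P_swap => /= /(P_catC (_ :: _ :: _)).
have P_front u x a y : P (u ++ x ++ a :: y) -> P (u ++ a :: x ++ y).
  elim: x u => // b x IHx u.
  by rewrite cat_cons -cat_rcons => /IHx; rewrite cat_rcons => /P_swap_in.
(* The target is built from the left; [u] collects the letters already in place. *)
move=> w w' ww'; rewrite -[w]cat0s -[w']cat0s; move: [::] => u.
elim: w' w u ww' => [|a w' IHw] w u; first by move/perm_nilP ->.
move=> ww'; have a_w : a \in w by rewrite (perm_mem ww') mem_head.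
case/splitPr: a_w ww' => x y ww' /P_front; rewrite -!cat_rcons; apply: IHw.
by rewrite -(perm_cons a) -(permPr ww') -cat_cons perm_sym -cat1s perm_catCA.
Qed.

(** * Words whose letters are exactly 0, ..., h *)

Definition spans (h : nat) (w : seq nat) : bool :=
  all (fun a => a <= h) w && all (fun i => i \in w) (iota 0 h.+1).

Lemma spans_perm (h : nat) (w w' : seq nat) :
  perm_eq w w' -> spans h w = spans h w'.
Proof.
move=> ww'; rewrite /spans (perm_all _ ww'); congr (_ && _).
by apply: eq_all => i; rewrite (perm_mem ww').
Qed.

Lemma spans_cat (h : nat) (u e : seq nat) :
  spans h u -> all (fun a => a <= h) e -> spans h (u ++ e).
Proof.
case/andP=> u_le /allP u_all e_le; rewrite /spans all_cat u_le e_le.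
by apply/allP => i /u_all; rewrite mem_cat => ->.
Qed.

(** Since [u] contains each of 0, ..., h, the whole word keeps spanning while [e] changes within
    these bounds, and unit transfers between letters suffice to reach [e']. *)
Lemma transfer_closed (h : nat) (P : seq nat -> Prop) :
    (forall w w', perm_eq w w' -> P w -> P w') ->
    (forall a b z, spans h [:: a, b.+1 & z] ->
       P [:: a.+1, b & z] -> P [:: a, b.+1 & z]) ->
  forall u e e', spans h u -> all (fun a => a <= h) e ->
    all (fun a => a <= h) e' -> size e = size e' -> sumn e = sumn e' ->
  P (u ++ e) -> P (u ++ e').
Proof.
move=> P_perm P_move u e e'.
have P_move_in v a b z : spans h v -> a < h -> b < h -> all (fun c => c <= h) z ->
    P (v ++ [:: a.+1, b & z]) -> P (v ++ [:: a, b.+1 & z]).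
  move=> v_sp a_le b_le z_le.
  move/(P_perm _ ([:: a.+1, b & z ++ v])); rewrite perm_catC => /(_ (perm_refl _)).
  have sp : spans h [:: a, b.+1 & z ++ v].
    rewrite (@spans_perm _ _ (v ++ [:: a, b.+1 & z])); first last.
      by rewrite perm_sym perm_catC.
    by apply: spans_cat; rewrite //= z_le b_le (ltnW a_le).
  by move/(P_move _ _ _ sp); apply: P_perm; rewrite perm_sym perm_catC.
(* The first letter of e is moved towards that of e' at the expense of the
   other letters; comparing sums shows that one of them has room. *)
elim: e' e u => [|a' e' IHe] [|a e] u //= u_sp /andP[a_le e_le] /andP[a'_le e'_le].
(* The sum of truncated differences is |a - a'|; [m] bounds it for the induction. *)
move=> [size_e]; move: {2}(_ + _) (leqnn ((a - a') + (a' - a))) => m.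
elim: m a e a_le e_le size_e => [|m IHm] a e a_le e_le size_e dist sum_e.
  have aa' : a = a' by lia.
  rewrite aa' -!cat_rcons; apply: IHe => //; last by lia.
  by rewrite -cats1; apply: spans_cat; rewrite //= a'_le.
case: (ltngtP a a') => [lt_a|lt_a'|aa'].
- have /hasP[[|b] //= b_e _] : has (fun b => 0 < b) e.
    apply/hasPn => e0; have : sumn e = 0; last by lia.
    elim: e e0 {sum_e size_e e_le} => //= c e IHs e0.
    have := e0 c (mem_head _ _).
    by have := IHs (fun x xe => e0 x (mem_behead (s := c :: e) xe)); lia.
  have e_b := perm_to_rem b_e.
  have := e_le; rewrite (perm_all _ e_b) /= => /andP[b_le r_le].
  (* [P_move_in] lowers the letter in front, so [b.+1] goes ahead of [a] for the move and back
     afterwards. *)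
  move/(P_perm _ (u ++ [:: b.+1, a & rem b.+1 e])).
  rewrite perm_cat2l -[X in perm_eq _ X]/([:: b.+1] ++ [:: a] ++ _) perm_sym.
  rewrite perm_catCA /= perm_cons perm_sym e_b => /(_ isT) /P_move_in Pba.
  have {Pba} : P (u ++ [:: b, a.+1 & rem b.+1 e]) by apply: Pba => //; lia.
  move/(P_perm _ (u ++ [:: a.+1, b & rem b.+1 e])).
  rewrite perm_cat2l -[X in perm_eq _ X]/([:: a.+1] ++ [:: b] ++ _) perm_sym.
  rewrite perm_catCA perm_refl => /(_ isT); apply: IHm => //=.
  + by lia.
  + by rewrite r_le (ltnW b_le).
  + by rewrite -size_e (perm_size e_b).
  + by lia.
  + by move: sum_e; rewrite (perm_sumn e_b) /=; lia.
- have /hasP[b b_e b_lt] : has (fun b => b < h) e.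
    apply/hasPn => e_h.
    have h_sum : sumn e = h * size e.
      elim: e e_h e_le {sum_e size_e} => [|c e IHs] e_h /=; first by rewrite muln0.
      move=> /andP[c_le e_le]; have := e_h c (mem_head _ _).
      have := IHs (fun x xe => e_h x (mem_behead (s := c :: e) xe)) e_le.
      by rewrite mulnS; lia.
    have : sumn e' <= h * size e'.
      elim: e' e'_le {IHe IHm sum_e size_e} => [|c e1 IHs] //= /andP[c_le /IHs].
      by rewrite mulnS; lia.
    by rewrite -size_e -h_sum; lia.
  case: a a_le dist sum_e lt_a' => // a a_le dist sum_e lt_a'.
  have e_b := perm_to_rem b_e.
  have := e_le; rewrite (perm_all _ e_b) /= => /andP[b_le r_le].
  move/(P_perm _ (u ++ [:: a.+1, b & rem b e])).
  rewrite perm_cat2l perm_cons e_b => /(_ isT) /P_move_in Pab.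
  have {Pab} : P (u ++ [:: a, b.+1 & rem b e]) by apply: Pab.
  apply: IHm => //=.
  + by lia.
  + by rewrite r_le b_lt.
  + by rewrite -size_e (perm_size e_b).
  + by lia.
  + by move: sum_e; rewrite (perm_sumn e_b) /=; lia.
- by apply: IHm => //; lia.
Qed.

(** * Connectedness under rotation and change of prefix *)

Definition hk_word (n h k : nat) (w : seq nat) : bool :=
  [&& size w == n, spans h w & sumn w == k].

Lemma hk_word_perm (n h k : nat) (w w' : seq nat) :
  perm_eq w w' -> hk_word n h k w = hk_word n h k w'.
Proof.
by move=> ww'; rewrite /hk_word (perm_size ww') (spans_perm _ _ _ ww') (perm_sumn ww').
Qed.

Lemma spans_split (h : nat) (w : seq nat) :
  spans h w -> exists2 e, perm_eq w (iota 0 h.+1 ++ e) & all (fun a => a <= h) e.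
Proof.
case/andP=> w_le w_all.
have [e we] : exists e, perm_eq w (iota 0 h.+1 ++ e).
  elim: (iota 0 h.+1) (iota_uniq 0 h.+1) w_all {w_le} => [|i s IHs] /=.
    by exists w.
  case/andP=> i_s /IHs {}IHs /andP[i_w /IHs[e we]].
  (* As [i] is not in [s], its occurrence in the word must lie in [e]. *)
  have i_e : i \in e by move: i_w; rewrite (perm_mem we) mem_cat (negPf i_s).
  exists (rem i e); apply: (perm_trans we).
  rewrite -cat1s perm_sym perm_catCA perm_cat2l perm_sym; exact: perm_to_rem.
by exists e => //; move: w_le; rewrite (perm_all _ we) all_cat => /andP[].
Qed.

(** As [d > 1], changing the first two letters is a change of prefix; this gives both the swaps for
    [perm_closed] and the transfers for [transfer_closed]. *)
Lemma hk_word_connected (n d h k : nat) (P : seq nat -> Prop) :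
    1 < d <= n -> coprime d n ->
    (forall w, P w -> hk_word n h k w) ->
    (forall w, P w -> P (rot d w)) ->
    (forall x y z, size x = d -> size y = d -> hk_word n h k (y ++ z) ->
       P (x ++ z) -> P (y ++ z)) ->
  forall w w', P w -> hk_word n h k w' -> P w'.
Proof.
case/andP=> d_gt1 d_le co_dn P_hk P_rot P_prefix.
have P_size w : P w -> size w = n by case/P_hk/and3P=> /eqP.
have P_pair a b a' b' z : hk_word n h k [:: a', b' & z] ->
    P [:: a, b & z] -> P [:: a', b' & z].
  move=> hk' Pab; have size_z := P_size _ Pab; move: hk' Pab.
  (* The pair followed by [d - 2] letters of [z] is a prefix of length [d]. *)
  rewrite -(cat_take_drop (d - 2) z).
  have size_t : size (take (d - 2) z) = d - 2.
    by rewrite size_takel //; move: size_z => /=; lia.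
  by apply: (P_prefix [:: a, b & _] [:: a', b' & _]) => /=; lia.
have P_perm : forall w w', perm_eq w w' -> P w -> P w'.
  apply: perm_closed.
    by apply: (@rot1_closed _ n d); rewrite // (leq_trans _ d_le) // ltnW.
  move=> a b z Pab; apply: P_pair (Pab).
  rewrite (@hk_word_perm _ _ _ _ [:: a, b & z]) ?P_hk //.
  by rewrite (perm_catCA [:: b] [:: a]).
move=> w w' Pw hk_w'; have /and3P[/eqP size_w sp_w /eqP sum_w] := P_hk _ Pw.
have /and3P[/eqP size_w' sp_w' /eqP sum_w'] := hk_w'.
have [e we e_le] := spans_split _ _ sp_w.
have [e' we' e'_le] := spans_split _ _ sp_w'.
apply: (P_perm (iota 0 h.+1 ++ e')); first by rewrite perm_sym.
apply: (transfer_closed h P P_perm _ _ e) => //.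
- move=> a b z sp Pab; apply: P_pair (Pab); have /and3P[] := P_hk _ Pab.
  by rewrite /hk_word sp /= addSnnS => -> _ ->.
- rewrite /spans; apply/andP; split; last exact/allP.
  by apply/allP => i; rewrite mem_iota.
- move: size_w'; rewrite -size_w (perm_size we) (perm_size we') !size_cat.
  by move/addnI.
- move: sum_w'; rewrite -sum_w (perm_sumn we) (perm_sumn we') !sumn_cat.
  by move/addnI.
- exact: P_perm we Pw.
Qed.

(** * The overlap cycle of weak orders *)

Lemma weak_orders_hkE (n h k : nat) (w : n.-tuple nat) :
  h < n -> weak_orders_hk h k w <-> hk_word n h k w.
Proof.
move=> h_lt; rewrite /hk_word size_tuple eqxx sumnE /=; split.
- case=> -[h' _ w_iota] w_h <-; rewrite /weight eqxx andbT.
  have <- : h' = h.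
    rewrite -w_h; apply/eqP; rewrite /height eqn_leq; apply/andP; split.
      by apply: (@leq_bigmax_seq _ _ xpredT id) => //; rewrite w_iota mem_iota; lia.
    by apply/bigmax_leqP_seq => i; rewrite w_iota mem_iota.
  apply/andP; split; apply/allP => i; first by rewrite w_iota mem_iota.
  by rewrite -w_iota.
- case/andP=> /andP[/allP w_le /allP w_all] /eqP w_k.
  have w_iota : w =i iota 0 h.+1.
    by move=> i; apply/idP/idP => [/w_le|/w_all //]; rewrite mem_iota.
  split=> //; first by exists h.
  apply/eqP; rewrite /height eqn_leq; apply/andP; split.
    by apply/bigmax_leqP_seq => i; rewrite w_iota mem_iota.
  by apply: (@leq_bigmax_seq _ _ xpredT id) => //; rewrite w_iota mem_iota; lia.
Qed.

(** Letters are at most [h], so the words are finitely many and can serve as the edges in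
    [eulerian_circuit]. *)
Lemma hk_word_enum (n h k : nat) :
  exists L : seq (n.-tuple nat), forall w, w \in L = hk_word n h k w.
Proof.
pose all_words := [seq [tuple of map val u] | u : n.-tuple 'I_h.+1].
exists [seq w : n.-tuple nat <- all_words | hk_word n h k w] => w.
rewrite mem_filter; case: (boolP (hk_word n h k w)) => //= /and3P[_ sp _].
have /andP[/allP w_le _] := sp.
apply/mapP; exists [tuple of map inord w]; first exact: mem_enum.
apply/val_inj; rewrite /= -map_comp -[LHS]map_id; apply/eq_in_map => a /w_le a_le.
by rewrite /= inordK.
Qed.

Theorem theorem4p4 (n s h k : nat)
  (n_gt0 : 0 < n) (s_bounds : 1 <= s <= n - 2)
  (k_gt0 : 0 < k) (k_le : k <= 'C(n, 2)) (h_lt : h < n)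
  (gcd_sn : gcdn s n = 1) :
  exists c : seq (n.-tuple nat), is_ocycle s (@weak_orders_hk n h k) c.
Proof.
have [L L_hk] := hk_word_enum n h k.
pose A : finType := seq_sub L.
pose d := n - s.
have hk_A (a : A) : hk_word n h k (val a) by rewrite -L_hk (valP a).
have rot_L (a : A) : [tuple of rot d (val a)] \in L.
  by rewrite L_hk /= (hk_word_perm _ _ _ _ (val a)) ?perm_rot.
(* The first [s] letters of the rotation by [d] are the last [s] of the word, so [r] gives a
   successor. *)
pose r (a : A) : A := SeqSub (rot_L a).
have r_inj : injective r.
  by move=> a b /(congr1 (fun c : A => val (val c))) /= /rot_inj /val_inj /val_inj.
pose hd (a : A) := drop d (val a); pose tl (a : A) := take s (val a).
have [||c [c_uniq c_A c_cycle]] := @eulerian_circuit A _ hd tl (perm r_inj).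
- move=> a; rewrite permE /tl /hd /= /rot take_size_cat //.
  by rewrite size_drop size_tuple /d; lia.
- move=> P P_r P_hd a b Pa.
  (* [Q] carries [P] from the finite type over to plain words. *)
  pose Q w := exists2 c : A, val (val c) = w & P c.
  suff [c /val_inj/val_inj <- //] : Q (val (val b)).
  have s_le : s <= n by lia.
  apply: (hk_word_connected n d h k Q _ _ _ _ _ (val (val a))).
  + by rewrite /d; lia.
  (* gcd(n - s, n) = gcd(n - s, s) = gcd(n, s) = 1. *)
  + by rewrite /coprime gcdnC -{1}(subnK s_le) gcdnC gcdnDl gcdnC -gcdnDl subnKC ?gcd_sn.
  + by move=> w [c <- _]; exact: hk_A.
  + by move=> w [c <- Pc]; exists (r c) => //; have := P_r _ Pc; rewrite permE.
  + move=> x y z size_x size_y hk_yz [c c_xz Pc].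
    have /and3P[size_yz _ _] := hk_yz.
    have yz_L : Tuple size_yz \in L by rewrite L_hk.
    exists (SeqSub yz_L) => //; apply: P_hd Pc.
    by rewrite /hd /= c_xz !drop_size_cat.
  + by exists a.
  + exact: hk_A.
exists (map val c); split.
- by rewrite map_inj_uniq //; apply: val_inj.
- move=> w; rewrite weak_orders_hkE // -L_hk; split=> [/mapP[a _ ->]|w_L].
    exact: valP.
  by apply/mapP; exists (SeqSub w_L); rewrite ?c_A.
- by rewrite cycle_map.
Qed.
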